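(* Let $A$ be a nonempty set, let $\wedge$ be a semilattice operation on $A$, and let $\mathcal{S} = \langle \wedge \rangle$ be the clone on $A$ generated by $\wedge$. Then the $\mathcal{S}$-minor partial order $\preccurlyeq_{\mathcal{S}}$ on $\mathcal{O}_A/{\equiv_{\mathcal{S}}}$ satisfies the descending chain condition.
   Context: Let $A$ be a nonempty (not necessarily finite) set. An operation on $A$ is a map $f\colon A^n \to A$ for some integer $n \geq 1$ (its arity). $\mathcal{O}_A$ denotes the set of all operations on $A$ (of all arities $n\ge 1$). The $i$-th $n$-ary projection is $(a_1,\dots,a_n)\mapsto a_i$. For $f$ of arity $n$ and $g_1,\dots,g_n$ all of arity $m$, the composition $f(g_1,\dots,g_n)$ is the $m$-ary operation $\mathbf{a} \mapsto f(g_1(\mathbf{a}),\dots,g_n(\mathbf{a}))$. A clone on $A$ is a set $\mathcal{C}\subseteq\mathcal{O}_A$ containing all projections and closed under composition (whenever the composition is defined). For $F\subseteq \mathcal{O}_A$, $\langle F\rangle$ denotes the smallest clone on $A$ containing $F$. A semilattice operation on $A$ is a binary operation $\wedge$ on $A$ that is associative, commutative and idempotent ($x\wedge x=x$). For a clone $\mathcal{C}$ on $A$ and $f,g\in\mathcal{O}_A$, with $f$ of arity $n$ and $g$ of arity $m$, $f$ is a $\mathcal{C}$-minor of $g$, written $f\leq_{\mathcal{C}} g$, if $f = g(h_1,\dots,h_m)$ for some ($n$-ary) $h_1,\dots,h_m\in\mathcal{C}$. The relation $\leq_{\mathcal{C}}$ is a preorder on $\mathcal{O}_A$. Write $f\equiv_{\mathcal{C}}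 g$ if $f\leq_{\mathcal{C}} g$ and $g\leq_{\mathcal{C}} f$. The $\mathcal{C}$-minor partial order $\preccurlyeq_{\mathcal{C}}$ is the partial order induced by $\leq_{\mathcal{C}}$ on the quotient $\mathcal{O}_A/{\equiv_{\mathcal{C}}}$. A partial order $(P;\leq)$ satisfies the descending chain condition if for every sequence $\cdots\leq a_3\leq a_2\leq a_1$ of elements of $P$ there is a positive integer $n$ such that $a_n=a_{n+1}=a_{n+2}=\cdots$. *)

(* Defs.v *)
From HB Require Import structures.
From mathcomp Require Import all_boot all_order.
From mathcomp Require Import boolp classical_sets.

Set Implicit Arguments.
Unset Strict Implicit.
Unset Printing Implicit Defensive.

Import Order.TTheory.
Local Open Scope classical_set_scope.

Definition operation (A : Type) (n : nat) := n.-tuple A -> A.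

(* Arities are at least 1: [Op n f] is an operation of arity [n.+1]. *)
Record op (A : Type) := Op { arity_pred : nat; opfun : operation A arity_pred.+1 }.
Arguments Op {A arity_pred} opfun.
Arguments opfun {A} f : rename.

HB.instance Definition _ (A : Type) := gen_eqMixin (op A).
HB.instance Definition _ (A : Type) := gen_choiceMixin (op A).

Definition arity (A : Type) (f : op A) : nat := (arity_pred f).+1.

Definition projection (A : Type) (n : nat) (i : 'I_n) : operation A n :=
  fun a => tnth a i.

Definition compose (A : Type) (n m : nat)
    (f : operation A n) (g : 'I_n -> operation A m) : operation A m :=
  fun a => f [tuple g i a | i < n].

Definition binop (A : Type) (w : A -> A -> A) : op A :=
  Op (fun a : 2.-tuple A => w (tnth a ord0) (tnth a ord_max)).

Record is_clone (A : Type) (C : set (op A)) : Prop := IsClone {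
  clone_projection : forall (n : nat) (i : 'I_n.+1), C (Op (projection (A := A) i));
  clone_compose : forall (n m : nat) (f : operation A n.+1)
    (g : 'I_n.+1 -> operation A m.+1),
    C (Op f) -> (forall i, C (Op (g i))) -> C (Op (compose f g)) }.

Record clone (A : Type) := Clone {
  clone_set : set (op A);
  cloneP : is_clone clone_set }.

Lemma generated_clone_subproof (A : Type) (F : set (op A)) :
  is_clone (smallest (@is_clone A) F).
Proof.
split=> [n i C [CC _]|n m f g Cf Cg C [CC FC]]; first exact: clone_projection.
by apply: clone_compose => // [|i]; [apply: Cf|apply: Cg].
Qed.

Definition generated_clone (A : Type) (F : set (op A)) : clone A :=
  Clone (generated_clone_subproof F).

Section Minor.
Variables (A : Type) (C : clone A).

Definition minor (f g : op A) : Prop :=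
  exists h : 'I_(arity g) -> operation A (arity f),
    (forall i, clone_set C (Op (h i))) /\ opfun f = compose (opfun g) h.

Lemma minor_refl f : minor f f.
Proof.
exists (@projection A _); split=> [i|]; first exact: (clone_projection (cloneP C)).
apply/funext => a; congr (opfun f _).
by apply: eq_from_tnth => i; rewrite tnth_mktuple.
Qed.

Lemma minor_trans g f k : minor f g -> minor g k -> minor f k.
Proof.
move=> [h [Ch fE]] [h' [Ch' gE]]; exists (fun i => compose (h' i) h).
split=> [i|]; first exact: (clone_compose (cloneP C)).
by rewrite fE gE.
Qed.

Definition minor_equiv (f g : op A) : bool := `[< minor f g /\ minor g f >].

Lemma minor_equiv_refl : reflexive minor_equiv.
Proof. by move=> f; apply/asboolP; split; apply: minor_refl. Qed.

Lemma minor_equiv_sym : symmetric minor_equiv.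
Proof. by move=> f g; apply/asboolP/asboolP => -[]. Qed.

Lemma minor_equiv_trans : transitive minor_equiv.
Proof.
move=> g f k /asboolP[fg gf] /asboolP[gk kg]; apply/asboolP.
by split; apply: (@minor_trans g).
Qed.

Canonical minor_equiv_rel :=
  EquivRel minor_equiv minor_equiv_refl minor_equiv_sym minor_equiv_trans.

Local Open Scope quotient_scope.

Definition minor_quotient := {eq_quot minor_equiv_rel}.
HB.instance Definition _ := Choice.on minor_quotient.
HB.instance Definition _ := EqQuotient.on minor_quotient.

(* The relation on representatives does not depend on their choice: see
   [minor_quotient_leE]. *)
Definition minor_quotient_le (x y : minor_quotient) : bool :=
  `[< minor (repr x) (repr y) >].

Lemma repr_minor (f : op A) :
  minor (repr (\pi_minor_quotient f)) f /\ minor f (repr (\pi_minor_quotient f)).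
Proof.
have : repr (\pi_minor_quotient f) = f %[mod minor_quotient] by rewrite reprK.
by move=> /eqmodP/asboolP.
Qed.

Lemma minor_quotient_leE (f g : op A) :
  minor_quotient_le (\pi f) (\pi g) = `[< minor f g >].
Proof.
have [rf fr] := repr_minor f; have [rg gr] := repr_minor g.
apply/asboolP/asboolP => H.
  exact: minor_trans fr (minor_trans H rg).
exact: minor_trans rf (minor_trans H gr).
Qed.

Lemma minor_quotient_le_refl : reflexive minor_quotient_le.
Proof. by move=> x; apply/asboolP; apply: minor_refl. Qed.

Lemma minor_quotient_le_anti : antisymmetric minor_quotient_le.
Proof.
move=> x y /andP[/asboolP xy /asboolP yx].
by rewrite -[x]reprK -[y]reprK; apply/eqmodP/asboolP.
Qed.

Lemma minor_quotient_le_trans : transitive minor_quotient_le.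
Proof.
by move=> y x z /asboolP xy /asboolP yz; apply/asboolP; apply: minor_trans xy yz.
Qed.

Fact minor_display : Order.disp_t. Proof. exact: Order.Disp tt tt. Qed.

HB.instance Definition _ := Order.Le_isPOrder.Build minor_display minor_quotient
  minor_quotient_le_refl minor_quotient_le_anti minor_quotient_le_trans.

End Minor.

Definition descending_chain_condition (d : Order.disp_t) (P : porderType d) : Prop :=
  forall a : nat -> P, (forall n, (a n.+1 <= a n)%O) ->
    exists n, forall m, n <= m -> a m = a n.

(* Main.v *)
Require Import Defs.
From mathcomp Require Import all_boot all_order.
From mathcomp Require Import boolp classical_sets.
Local Open Scope classical_set_scope.

(** The members of the clone generated by a semilattice operation are the meets
    of nonempty sets of variables. So a minor [f = g(h_1, ..., h_m)] of [g] is
    given by nonempty sets [S_1, ..., S_m] of variables of [f]. Sort each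
    variable [x] of [f] by its type [{i | x \in S_i}]: variables of the same
    type can be merged into their meet and variables of empty type are
    inessential, so up to equivalence [f] depends only on the set of nonempty
    types that occur. Hence [g] has only finitely many minors up to equivalence,
    and a descending chain with finitely many values is stationary. *)

Definition meet_le {A : Type} (w : A -> A -> A) (x y : A) : Prop := w x y = x.

Lemma meet_le_meet {A : Type} (w : A -> A -> A) (w_assoc : associative w)
    (w_comm : commutative w) (w_idem : idempotent_op w) (z x y : A) :
  meet_le w z (w x y) <-> meet_le w z x /\ meet_le w z y.
Proof.
rewrite /meet_le; split=> [zxy|[zx zy]]; last by rewrite w_assoc zx.
split; rewrite -{1}zxy.
  by rewrite -w_assoc -w_assoc (w_comm y) (w_assoc x x) w_idem.
by rewrite -w_assoc -w_assoc w_idem.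
Qed.

(** Antisymmetry in a form that lets two elements be compared through their lower bounds. *)
Lemma meet_le_ext {A : Type} (w : A -> A -> A) (w_comm : commutative w)
    (w_idem : idempotent_op w) (x y : A) :
  (forall z, meet_le w z x <-> meet_le w z y) -> x = y.
Proof.
move=> xy; have /xy xley : meet_le w x x by exact: w_idem.
have /xy ylex : meet_le w y y by exact: w_idem.
by rewrite -xley w_comm ylex.
Qed.

(** Meets are specified by their lower bounds, since an iterated [w] would call for a unit and an
    order of the factors. *)
Definition is_meet {A : Type} (w : A -> A -> A) {n : nat} (S : {set 'I_n})
    (h : operation A n) : Prop :=
  forall a z, meet_le w z (h a) <-> forall i, i \in S -> meet_le w z (tnth a i).

(** Projections are meets over singletons, and a meet over [S] of meets over the [T i] is the meet
    over their union. *)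
Lemma is_clone_is_meet {A : Type} (w : A -> A -> A) :
  is_clone (fun f : op A => exists S, S != finset.set0 /\ is_meet w S (opfun f)).
Proof.
split=> [n i|n m f g [S [/finset.set0Pn[i0 Si0] fS]] gP]; last first.
  have /choice[T gT] i : exists S, S != finset.set0 /\ is_meet w S (g i) by exact: gP.
  exists (\bigcup_(i in S) T i)%SET; split.
    have [/finset.set0Pn[j Tj] _] := gT i0.
    by apply/finset.set0Pn; exists j; apply/finset.bigcupP; exists i0.
  move=> a z; split=> [/fS zS j /finset.bigcupP[i Si Tj]|zT].
    have [_ /(_ a z) [+ _]] := gT i; apply=> //.
    by have := zS i Si; rewrite tnth_mktuple.
  apply/fS => i Si; rewrite tnth_mktuple; have [_ /(_ a z) [_]] := gT i; apply.
  by move=> j Tj; apply: zT; apply/finset.bigcupP; exists i.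
exists [set i]%SET; split; first by apply/finset.set0Pn; exists i; rewrite finset.in_set1.
by move=> a z; split=> [zi j /finset.set1P -> //|]; apply; rewrite finset.in_set1.
Qed.

Lemma generated_is_meet {A : Type} (w : A -> A -> A) (w_assoc : associative w)
    (w_comm : commutative w) (w_idem : idempotent_op w) (f : op A) :
  clone_set (generated_clone [set binop w]) f ->
  exists S, S != finset.set0 /\ is_meet w S (opfun f).
Proof.
move=> /(_ _ (conj (is_clone_is_meet w) _)); apply.
move=> _ ->; exists [set: 'I_2]%SET; split.
  by apply/finset.set0Pn; exists ord0; rewrite finset.in_setT.
move=> a z; split=> [/(meet_le_meet w w_assoc w_comm w_idem)[z0 z1] i _|za].
  by case: i => -[|[|//]] ?; [move: z0|move: z1]; congr (meet_le w z (tnth a _));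
    apply: val_inj.
by apply/(meet_le_meet w w_assoc w_comm w_idem); split; apply: za; rewrite finset.in_setT.
Qed.

Lemma exists_generated_meet {A : Type} (w : A -> A -> A) (w_assoc : associative w)
    (w_comm : commutative w) (w_idem : idempotent_op w) (n : nat)
    (S : {set 'I_n.+1}) :
  S != finset.set0 ->
  exists2 h : operation A n.+1,
    clone_set (generated_clone [set binop w]) (Op h) & is_meet w S h.
Proof.
move=> /finset.set0Pn[i0 Si0].
pose C := generated_clone [set binop w].
(* Putting [i0] in front of the list lets the induction start from a projection; its repetition does
   not change the lower bounds. *)
suff [h Ch hP] : exists2 h : operation A n.+1, clone_set C (Op h) &
    forall a z, meet_le w z (h a) <->
      forall i, i \in i0 :: enum S -> meet_le w z (tnth a i).
  exists h => // a z; rewrite hP; split=> za i iS; apply: za.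
    by rewrite inE mem_enum iS orbT.
  by move: iS; rewrite inE mem_enum => /predU1P[->|].
elim: (enum S) => [|j s [h Ch hP]].
  exists (projection i0); first exact: (clone_projection (cloneP C)).
  by move=> a z; split=> [zi i|]; [rewrite inE => /eqP->|apply; rewrite inE].
exists (compose (opfun (binop w))
         (fun i : 'I_2 => if i == ord0 then projection j else h)).
  apply: (clone_compose (cloneP C)) => [|i].
    by move=> D [_]; apply.
  by case: ifP => _ //; exact: (clone_projection (cloneP C)).
move=> a z; rewrite /compose /= !tnth_mktuple /=.
rewrite (meet_le_meet w w_assoc w_comm w_idem) hP; split=> [[zj zs] i|zs].
  by rewrite !inE => /or3P[/eqP->|/eqP->|si] //; apply: zs; rewrite inE ?eqxx ?si ?orbT.
split; first by apply: zs; rewrite !inE eqxx orbT.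
by move=> i; rewrite inE => /predU1P[->|si]; apply: zs; rewrite !inE ?eqxx ?si ?orbT.
Qed.

Definition var_type {n m : nat} (S : 'I_m -> {set 'I_n}) (l : 'I_n) : {set 'I_m} :=
  [set i | l \in S i]%SET.

Definition var_types {n m : nat} (S : 'I_m -> {set 'I_n}) : {set {set 'I_m}} :=
  ([set var_type S l | l : 'I_n] :\ finset.set0)%SET.

Lemma mem_var_types {n m : nat} (S : 'I_m -> {set 'I_n}) (i : 'I_m) (l : 'I_n) :
  l \in S i -> var_type S l \in var_types S.
Proof.
move=> Sl; rewrite !inE; apply/andP; split; last by apply/imsetP; exists l.
by apply/finset.set0Pn; exists i; rewrite inE.
Qed.

Lemma var_typesP {n m : nat} (S : 'I_m -> {set 'I_n}) (t : {set 'I_m}) :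
  t \in var_types S -> exists l, t = var_type S l.
Proof. by rewrite !inE => /andP[_ /imsetP[l _ ->]]; exists l. Qed.

(** The type of [t] is finite and depends on [g] alone, whatever the arity of [f]. *)
Definition minor_with_types {A : Type} (w : A -> A -> A) (g f : op A)
    (t : {set {set 'I_(arity g)}}) : Prop :=
  exists (h : 'I_(arity g) -> operation A (arity f)) (S : 'I_(arity g) -> _),
    [/\ opfun f = compose (opfun g) h, forall i, is_meet w (S i) (h i)
      & var_types S = t].

Lemma minor_has_types {A : Type} (w : A -> A -> A) (w_assoc : associative w)
    (w_comm : commutative w) (w_idem : idempotent_op w) (f g : op A) :
  minor (generated_clone [set binop w]) f g -> exists t, minor_with_types w g f t.
Proof.
move=> [h [Ch fE]].
have /choice[S hS] i : exists S, is_meet w S (h i).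
  by have [S [_ hS]] := generated_is_meet w w_assoc w_comm w_idem _ (Ch i); exists S.
by exists (var_types S), h, S.
Qed.

(** Replace each variable of [f'] by the meet of all variables of [f] of the same type. Since both
    realise the same nonempty types, this turns the meet over [S' i] into the meet over [S i]. *)
Lemma same_types_minor {A : Type} (w : A -> A -> A) (w_assoc : associative w)
    (w_comm : commutative w) (w_idem : idempotent_op w) (g f f' : op A)
    (t : {set {set 'I_(arity g)}}) :
  minor_with_types w g f t -> minor_with_types w g f' t ->
  minor (generated_clone [set binop w]) f f'.
Proof.
move=> [h [S [fE hS tE]]] [h' [S' [f'E hS' t'E]]].
pose C := generated_clone [set binop w].
have /choice[k kP] (j : 'I_(arity f')) : exists k : operation A (arity f),
    clone_set C (Op k) /\ (var_type S' j \in t ->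
      is_meet w [set l | var_type S l == var_type S' j]%SET k).
  have [jt|_] := boolP (_ \in t); last first.
    (* As [t] is [var_types S'], only the empty type is missing from it; such a [j] lies in no
       [S' i], so the projection is an arbitrary choice. *)
    by exists (projection ord0); split=> //; exact: (clone_projection (cloneP C)).
  have [|k Ck kP] := exists_generated_meet w w_assoc w_comm w_idem _
    [set l | var_type S l == var_type S' j]%SET; last by exists k.
  move: jt; rewrite -tE => /var_typesP[l jl].
  by apply/finset.set0Pn; exists l; rewrite inE jl.
exists k; split=> [j|]; first by have [] := kP j.
rewrite fE f'E; apply/funext => a; congr (opfun g _); apply: eq_from_tnth => i.
rewrite !tnth_mktuple; apply: (meet_le_ext w w_comm w_idem) => z.
rewrite hS hS'; split=> [za j S'j|zk l Sl].
  have jt : var_type S' j \in t by rewrite -t'E (mem_var_types _ i).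
  rewrite tnth_mktuple; have [_ /(_ jt a z) ->] := kP j => l.
  rewrite inE => /eqP/setP/(_ i); rewrite !inE S'j => Sl; exact: za.
(* The type of [l] is also realised by some variable [j] of [f']; it contains [i], so [j] is in
   [S' i]. *)
have lt : var_type S l \in t by rewrite -tE (mem_var_types _ i).
move: (lt); rewrite -{1}t'E => /var_typesP[j lj].
have S'j : j \in S' i by move/setP: lj => /(_ i); rewrite !inE Sl.
have := zk j S'j; rewrite tnth_mktuple; have [_] := kP j.
by rewrite -lj => /(_ lt a z) -> /(_ l); apply; rewrite inE.
Qed.

Lemma infinite_pigeonhole (T : finType) (c : nat -> T) :
  exists v, forall N, exists2 m, N <= m & c m = v.
Proof.
apply/not_existsP => H.
have /choice[N NP] v : exists N, forall m, N <= m -> c m <> v.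
  have /existsNP[N NP] := H v; exists N => m Nm cm; apply: NP; by exists m.
(* Beyond the largest of the bounds [N v] no value could occur at all. *)
apply: (NP (c (\max_v N v)) (\max_v N v)) => //.
exact: (leq_bigmax (c (\max_v N v))).
Qed.

Lemma descending_finite_stationary (d : Order.disp_t) (P : porderType d)
    (T : finType) (a : nat -> P) (c : nat -> T) :
  (forall n, (a n.+1 <= a n)%O) -> (forall n m, c n = c m -> a n = a m) ->
  exists n, forall m, n <= m -> a m = a n.
Proof.
move=> a_dec ca.
have a_mono n m : n <= m -> (a m <= a n)%O.
  move=> /subnK <-; elim: (m - n) => [|p IHp]; first exact: Order.POrderTheory.lexx.
  exact: Order.POrderTheory.le_trans (a_dec _) IHp.
have [v cv] := infinite_pigeonhole T c; have [n _ cn] := cv 0.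
(* A later occurrence [p] of the recurring value squeezes [a m] between [a p] and [a n], which are
   equal. *)
exists n => m nm; have [p mp cp] := cv m.
apply: Order.POrderTheory.le_anti; rewrite a_mono //= (ca n p) ?cn //; exact: a_mono.
Qed.

Theorem theorem3p1 (A : Type) (A_nonempty : inhabited A) (w : A -> A -> A)
    (w_assoc : associative w) (w_comm : commutative w) (w_idem : idempotent_op w) :
  descending_chain_condition (minor_quotient (generated_clone [set binop w])).
Proof.
move=> a a_dec; pose C := generated_clone [set binop w].
(* Every term is a minor of the first, so all types are taken relative to the single operation
   [repr (a 0)]. *)
have a_min n : minor C (repr (a n)) (repr (a 0)).
  elim: n => [|n IHn]; first exact: minor_refl.
  by apply: minor_trans IHn; apply/asboolP; exact: a_dec.
have /choice[c cP] n := minor_has_types w w_assoc w_comm w_idem _ _ (a_min n).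
apply: (descending_finite_stationary _ _ _ a c) => // n m cnm.
have cm := cP m; rewrite -cnm in cm.
apply: minor_quotient_le_anti; apply/andP; split; apply/asboolP.
  exact: same_types_minor w_assoc w_comm w_idem _ _ _ _ (cP n) cm.
exact: same_types_minor w_assoc w_comm w_idem _ _ _ _ cm (cP n).
Qed.
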